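(* Suppose the state space $\mathbb{X}=\{1,\dots,N\}$ is finite. Let $(\lambda_n)_{n\in\mathbb{N}}$ be any sequence of positive numbers with $\lambda_n\to0$, and for each $n$ let $p^n$ be a randomized regular equilibrium of the entropy-regularized Stackelberg stopping game with parameter $\lambda_n$. Then there exists a limit point $(p^*,(r^*,q^* ))\in[0,1]^N\times([0,1]^N\times[0,1]^N)$ of the sequence $\big(p^n,(r^{*,\lambda_n},q^{*,\lambda_n}(p^n))\big)_n$ that constitutes a randomized feedback equilibrium of the unregularized game, i.e. there is a map $\mathbf{q}:\mathcal{R}_0\to\mathcal{R}_0$ with $\mathbf{q}(p^* )=q^*$ such that $(p^*,(r^*,\mathbf{q}))$ is a randomized feedback equilibrium.
   Context: $X=(X_t)_{t\ge0}$ is a time-homogeneous Markov chain on $\mathbb{X}=\{1,\dots,N\}$; $\mathbb{E}_x$ is expectation given $X_0=x$. $f_i,g_i,h_i:\mathbb{X}\to\mathbb{R}$ ($i=1,2$), $\delta_1,\delta_2\in(0,1)$. $\mathcal{R}_0=[0,1]^N$ is the set of functions $p:\mathbb{X}\to[0,1]$. $Y,Y'$ are independent i.i.d. uniform $[0,1]$ sequences independent of $X$. The leader using $p\in\mathcal{R}_0$ stops at $\tau^p=\inf\{t\ge0:Y_t\le p_{X_t}\}$; the follower using $(r,q)\in\mathcal{R}_0^2$ stops at $\tau^{r,q}=\inf\{t\ge0:Y'_t\le r_{X_t}1_{\{\tau^p\le t\}}+q_{X_t}1_{\{\tau^p>t\}}\}$. With $F_1(\tau,\rho)=f_1(X_\tau)1_{\{\tau<\rho\}}+g_1(X_\rho)1_{\{\rho<\tau\}}+h_1(X_\tau)1_{\{\rho=\tau\}}$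 and $F_2(\tau,\rho)=f_2(X_\rho)1_{\{\rho<\tau\}}+g_2(X_\tau)1_{\{\tau<\rho\}}+h_2(X_\rho)1_{\{\rho=\tau\}}$, let $J_i(x,p,(r,q))=\mathbb{E}_x[\delta_i^{\tau^p\wedge\tau^{r,q}}F_i(\tau^p,\tau^{r,q})]$ (zero payoff if nobody stops), and, with $\mathcal{H}(q)=-q\log q-(1-q)\log(1-q)$, $$J_2^\lambda(x,p,(r,q))=J_2(x,p,(r,q))+\lambda\,\mathbb{E}_x\Big[\sum_{t=0}^{\tau^p\wedge\tau^{r,q}}\delta_2^t\,\mathcal{H}\big(q_{X_t}1_{\{\tau^p>t\}}+r_{X_t}1_{\{\tau^p=t\}}\big)\Big].$$ For $p'\in\mathcal{R}_0$, $p'\oplus_1p$ means the leader uses $p'$ at the first step and $p$ afterwards, and $J_1(x,p'\oplus_1p,(r,q))=p'_x[r_xh_1(x)+(1-r_x)f_1(x)]+(1-p'_x)[q_xg_1(x)+(1-q_x)\delta_1\mathbb{E}_x[J_1(X_1,p,(r,q))]]$. Regularized game: the follower's optimal response to $p$ is $$r^{*,\lambda}_x=\frac1{1+\exp((g_2(x)-h_2(x))/\lambda)},\qquad q^{*,\lambda}_x(p)=\frac{1}{1+\exp\big((\delta_2\mathbb{E}_x[p_{X_1}W^\lambda_S(X_1)+(1-p_{X_1})W^\lambda_C(X_1,p)]-f_2(x))/\lambda\big)},$$ where $W_S^\lambda(x)=\sup_{r\in[0,1]}\{rh_2(x)+(1-r)g_2(x)+\lambda\mathcal{H}(r)\}$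 and $W_C^\lambda(x,p)=\sup_{(r,q)\in\mathcal{R}_0^2}\{q_xf_2(x)+(1-q_x)\delta_2\mathbb{E}_x[J_2^\lambda(X_1,p,(r,q))]+\lambda\mathcal{H}(q_x)\}$. $p$ is a randomized regular equilibrium with parameter $\lambda$ if, with $(r,q)=(r^{*,\lambda},q^{*,\lambda}(p))$, for all $x$: $J_2^\lambda(x,p,(r,q))=\sup_{(r',q')\in\mathcal{R}_0^2}J_2^\lambda(x,p,(r',q'))$ and $J_1(x,p,(r,q))=\sup_{p'\in\mathcal{R}_0}J_1(x,p'\oplus_1p,(r,q))$. Feedback equilibrium (unregularized game): let $\mathcal{Q}$ be the set of maps $\mathbf{q}:\mathcal{R}_0\to\mathcal{R}_0$. $(p,(r,\mathbf{q}))\in\mathcal{R}_0\times(\mathcal{R}_0\times\mathcal{Q})$ is a randomized feedback equilibrium if $J_2(x,p',(r,\mathbf{q}(p')))\ge J_2(x,p',(r',\mathbf{q}'(p')))$ for all $x\in\mathbb{X}$, $p',r'\in\mathcal{R}_0$, $\mathbf{q}'\in\mathcal{Q}$, and $J_1(x,p,(r,\mathbf{q}(p)))\ge J_1(x,p'\oplus_1p,(r,\mathbf{q}(p'\oplus_1p)))$ for all $x\in\mathbb{X}$, $p'\in\mathcal{R}_0$, where, since the follower's response when the leader continues depends only on the leader's future strategy, $J_1(x,p'\oplus_1p,(r,\mathbf{q}(p'\oplus_1p)))=J_1(x,p'\oplus_1p,(r,\mathbf{q}(p)))$. *)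

(* Defs.v *)
From HB Require Import structures.
From mathcomp Require Import all_boot all_order all_algebra.
From mathcomp Require Import all_classical all_reals all_analysis.
Import Order.TTheory GRing.Theory Num.Theory.
Import numFieldNormedType.Exports.

Set Implicit Arguments.
Unset Strict Implicit.
Unset Printing Implicit Defensive.

Local Open Scope classical_set_scope.
Local Open Scope ring_scope.

(* A time-homogeneous Markov chain X on 'I_N, given as a family of laws        *)
(* law x = "P given X_0 = x" on one sample space T, together with the uniform  *)
(* sequences Y (leader) and Y' (follower). The transition probability from z   *)
(* to y is law z [set w | X 1 w = y]. Taking some A t := setT, A' t := setT or *)
(* C t := setT in XYY'_indep gives the product rule for every finite           *)
(* subfamily of the Y_t's and Y'_t's together with the process X.              *)
Record chain (R : realType) (N : nat) (d : measure_display)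
    (T : measurableType d) := Chain {
  law : 'I_N -> probability T R ;
  X : nat -> T -> 'I_N ;
  Y : nat -> T -> R ;
  Y' : nat -> T -> R ;
  measurable_X : forall t y, measurable [set w | X t w = y] ;
  measurable_Y : forall t, measurable_fun setT (Y t) ;
  measurable_Y' : forall t, measurable_fun setT (Y' t) ;
  X_start : forall x, law x [set w | X 0 w = x] = 1%E ;
  X_markov : forall x n (s : nat -> 'I_N) y,
    law x [set w | (forall t, (t <= n)%N -> X t w = s t) /\ X n.+1 w = y] =
    (law x [set w | forall t, (t <= n)%N -> X t w = s t] *
     law (s n) [set w | X 1 w = y])%E ;
  Y_uniform : forall x t (A : set R), measurable A ->
    law x (Y t @^-1` A) = uniform_prob (@ltr01 R) A ;
  Y'_uniform : forall x t (A : set R), measurable A ->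
    law x (Y' t @^-1` A) = uniform_prob (@ltr01 R) A ;
  XYY'_indep : forall x n (C : nat -> set 'I_N) (A A' : nat -> set R),
    (forall t, measurable (A t)) -> (forall t, measurable (A' t)) ->
    law x [set w | forall t, (t < n)%N ->
                     [/\ C t (X t w), A t (Y t w) & A' t (Y' t w)]] =
    (law x [set w | forall t, (t < n)%N -> C t (X t w)] *
     (\prod_(t < n) law x (Y t @^-1` A t)) *
     (\prod_(t < n) law x (Y' t @^-1` A' t)))%E }.

Record game (R : realType) (N : nat) := Game {
  f1 : 'I_N -> R ; g1 : 'I_N -> R ; h1 : 'I_N -> R ;
  f2 : 'I_N -> R ; g2 : 'I_N -> R ; h2 : 'I_N -> R ;
  delta1 : R ; delta2 : R ;
  delta1_itv : 0 < delta1 < 1 ;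
  delta2_itv : 0 < delta2 < 1 }.

(* [0,1]^N; {ptws _ -> _} is the function space with the product topology.     *)
Definition R0 (R : realType) (N : nat) : set {ptws 'I_N -> R} :=
  [set p | forall x, 0 <= p x <= 1].

(* inf A in the extended reals; it is +oo when A is empty.                     *)
Definition first_time (R : realType) (A : set nat) : \bar R :=
  ereal_inf [set t%:R%:E | t in A].

(* s is +oo or a natural number; for s = +oo the junk value is multiplied by 0 *)
(* wherever it occurs below.                                                   *)
Definition step (R : realType) (s : \bar R) : nat := Num.truncn (fine s).

Definition discount (R : realType) (dl : R) (s : \bar R) : R :=
  if s == +oo%E then 0 else dl ^+ step s.

(* x ln x vanishes at x = 0, in agreement with 0 log 0 = 0.                    *)
Definition entropy (R : realType) (q : R) : R :=
  - q * ln q - (1 - q) * ln (1 - q).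

(* Leader strategies may depend on time: always p is the stationary strategy   *)
(* p, and first_then p' p is p' (+)_1 p.                                       *)
Definition always (R : realType) (N : nat) (p : {ptws 'I_N -> R}) :
  nat -> {ptws 'I_N -> R} := fun=> p.

Definition first_then (R : realType) (N : nat) (p' p : {ptws 'I_N -> R}) :
  nat -> {ptws 'I_N -> R} := fun t => if t is 0%N then p' else p.

Section stopping_game.
Context (R : realType) (N : nat) (d : measure_display) (T : measurableType d).
Variables (S : chain R N T) (G : game R N).

Local Notation strategy := {ptws 'I_N -> R}.
Local Notation R0 := (@R0 R N).
Implicit Types (x : 'I_N) (s : \bar R) (w : T) (p r q : strategy)
  (pi : nat -> strategy) (rq : strategy * strategy) (lam : R).

Definition tau1 pi w : \bar R :=
  first_time R [set t | Y S t w <= pi t (X S t w)].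

Definition tau2 pi rq w : \bar R :=
  first_time R [set t | Y' S t w <=
    rq.1 (X S t w) * (tau1 pi w <= t%:R%:E)%E%:R +
    rq.2 (X S t w) * (t%:R%:E < tau1 pi w)%E%:R].

Definition F1 s s' w : R :=
  f1 G (X S (step s) w) * (s < s')%E%:R +
  g1 G (X S (step s') w) * (s' < s)%E%:R +
  h1 G (X S (step s) w) * (s' == s)%:R.

Definition F2 s s' w : R :=
  f2 G (X S (step s') w) * (s' < s)%E%:R +
  g2 G (X S (step s) w) * (s < s')%E%:R +
  h2 G (X S (step s') w) * (s' == s)%:R.

Definition payoff1 pi rq w : R :=
  let s := tau1 pi w in let s' := tau2 pi rq w in
  discount (delta1 G) (mine s s') * F1 s s' w.

Definition payoff2 pi rq w : R :=
  let s := tau1 pi w in let s' := tau2 pi rq w in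
  discount (delta2 G) (mine s s') * F2 s s' w.

Definition J1 x pi rq : R := fine 'E_(law S x)[payoff1 pi rq].

Definition J2 x pi rq : R := fine 'E_(law S x)[payoff2 pi rq].

Definition entropy_payoff pi rq w : \bar R :=
  let s := tau1 pi w in let s' := tau2 pi rq w in
  (\sum_(0 <= t <oo | t%:R%:E <= mine s s')
    (delta2 G ^+ t *
     entropy (rq.2 (X S t w) * (t%:R%:E < s)%E%:R +
              rq.1 (X S t w) * (s == t%:R%:E)%:R))%:E)%E.

Definition J2reg lam x pi rq : R :=
  J2 x pi rq + lam * fine (\int[law S x]_w entropy_payoff pi rq w)%E.

Definition E1 x (phi : 'I_N -> R) : R :=
  fine 'E_(law S x)[fun w => phi (X S 1 w)].

Definition W_S lam x : R :=
  sup [set r * h2 G x + (1 - r) * g2 G x + lam * entropy r | r in `[0, 1]].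

Definition W_C lam x p : R :=
  sup [set rq.2 x * f2 G x
           + (1 - rq.2 x) * (delta2 G * E1 x (fun y => J2reg lam y (always p) rq))
           + lam * entropy (rq.2 x) | rq in R0 `*` R0].

Definition r_reg lam : strategy := fun x =>
  1 / (1 + expR ((g2 G x - h2 G x) / lam)).

Definition q_reg lam p : strategy := fun x =>
  1 / (1 + expR ((delta2 G *
    E1 x (fun y => p y * W_S lam y + (1 - p y) * W_C lam y p) - f2 G x) / lam)).

Definition regular_equilibrium lam p : Prop :=
  R0 p /\ let rq := (r_reg lam, q_reg lam p) in
  forall x,
    J2reg lam x (always p) rq =
      sup [set J2reg lam x (always p) rq' | rq' in R0 `*` R0] /\
    J1 x (always p) rq = sup [set J1 x (first_then p' p) rq | p' in R0].

Definition response_map (q : strategy -> strategy) : Prop :=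
  forall p, R0 p -> R0 (q p).

(* In the leader's condition the follower answers p' (+)_1 p with q p, as the  *)
(* response while the leader continues depends only on the leader's future     *)
(* strategy.                                                                   *)
Definition feedback_equilibrium p r (q : strategy -> strategy) : Prop :=
  [/\ R0 p, R0 r, response_map q,
    (forall x p' r' (q' : strategy -> strategy),
        R0 p' -> R0 r' -> response_map q' ->
        J2 x (always p') (r', q' p') <= J2 x (always p') (r, q p')) &
    (forall x p', R0 p' ->
        J1 x (first_then p' p) (r, q p) <= J1 x (always p) (r, q p))].

End stopping_game.

(* Main.v *)
(* The value of a pair of stationary randomized strategies is the unique       *)
(* solution of a linear Bellman equation, which is a contraction since the     *)
(* discount factor is smaller than 1. It is obtained by splitting the payoff   *)
(* over the stopping date and the path of the chain. Hence values depend       *)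
(* continuously on the strategies. Along an ultrafilter finer than [\oo] all   *)
(* strategies converge coordinatewise. The entropy term is bounded, so its     *)
(* weight lam n makes it disappear in the limit, and the two optimality        *)
(* conditions of the regular equilibria pass to the limit; so does the         *)
(* statewise optimality of r_reg, up to an error lam n. Away from the limit    *)
(* point, the response map is completed by optimal pure replies.               *)
Require Import Defs.
From HB Require Import structures.
From mathcomp Require Import all_boot all_order all_algebra.
From mathcomp Require Import all_classical all_reals all_analysis.
From mathcomp Require Import ring lra zify.
Import Order.TTheory GRing.Theory Num.Theory.
Import numFieldNormedType.Exports.

Set Implicit Arguments.
Unset Strict Implicit.
Unset Printing Implicit Defensive.

Local Open Scope classical_set_scope.
Local Open Scope ring_scope.

(** Fix an ultrafilter finer than [\oo]. By compactness of [[0, 1]] the strategies [p n], [r_reg]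
    and [q_reg] converge along it in every coordinate, and their limits [ps], [rs], [qs] form a
    cluster point. It remains to pass to the limit in the optimality conditions.

    This requires the payoffs to be continuous in all strategies jointly. Nobody stops before date
    [t] exactly when all earlier uniforms exceed their thresholds, so independence and the Markov
    property give the law of the surviving chain, and the payoff is a discounted sum of stage
    payoffs with explicit means. Dominated convergence turns this into a one-step equation
    ([stop_value_bellman]). For stationary strategies a maximum principle ([bellman_comparison])
    makes its solution unique and bounded independently of the strategies. A limit of values
    therefore exists along the ultrafilter and solves the limiting equation, so it is the limiting
    value ([stop_value_ultra_cvg]).

    The entropy term lies between 0 and a constant, so in the regularized game the follower's reply
    is optimal for [J2] up to [lam n] times that constant ([regular_equilibrium_reply]), and [qs]
    with [rs] is optimal against [ps]. The leader's inequality compares one application of the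
    Bellman operator with a value, and both sides converge.

    A feedback equilibrium also demands an optimal reply to every other leader strategy, with the
    same [rs]. This is possible because [rs] is optimal state by state, whatever the leader does
    ([logistic_near_max]), so only the other component has to be chosen anew ([best_reply_exists]).
    The leader's condition involves the response map at [ps] alone and is unaffected by that
    choice. *)

(** * Total probability along a map with finitely many values *)

Section fibers.
Context (R : realType) (d : measure_display) (T : measurableType d).
Context (I : finType) (f : T -> I).

Lemma bigcup_fibers (E : set T) : \bigcup_i (E `&` [set w | f w = i]) = E.
Proof.
apply/seteqP; split=> [w [i _ []]//|w Ew].
by exists (f w).
Qed.

Lemma measurable_fibers (E : set T) :
  (forall i, measurable (E `&` [set w | f w = i])) -> measurable E.
Proof.
move=> mE; rewrite -(bigcup_fibers E).
by apply: fin_bigcup_measurable => //; exact: finite_finset.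
Qed.

(** Measurability is asked of the pieces only, so [f] may be the state at one date or the whole path
    up to a date. *)
Lemma probability_fibers (P : probability T R) (E : set T) :
  (forall i, measurable (E `&` [set w | f w = i])) ->
  P E = (\sum_i P (E `&` [set w | f w = i]))%E.
Proof.
move=> mE; rewrite -[in LHS](bigcup_fibers E) measure_fin_bigcup//.
- have -> : [set: I] = [set` index_enum I].
    by apply/seteqP; split=> i //= _; rewrite mem_index_enum.
  by rewrite -fsbig_seq// index_enum_uniq.
- exact: finite_finset.
- by move=> i j _ _ [w [[_ /= <-] [_ /= <-]]].
Qed.

End fibers.

(** * Stopping probabilities from uniform variables *)

Section uniform.
Context (R : realType).

Lemma uniform_prob_le (c : R) : 0 <= c <= 1 ->
  uniform_prob (@ltr01 R) [set u | u <= c] = c%:E.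
Proof.
move=> /andP[c0 c1]; rewrite /uniform_prob integral_uniform_pdf.
have -> : [set u : R | u <= c] `&` `[0, 1]%classic = `[0, c]%classic.
  apply/seteqP; split=> u /=; rewrite !in_itv/=.
    by move=> [-> /andP[->]].
  by move=> /andP[-> uc]; rewrite uc (le_trans uc c1).
rewrite (eq_integral (cst 1%:E)); last first.
  move=> u; rewrite inE/= in_itv/= /uniform_pdf => /andP[u0 uc].
  by rewrite u0 (le_trans uc c1)/= subr0 invr1.
rewrite integral_cst//= mul1e lebesgue_measure_itv/= lte_fin.
by case: ltP => // c0'; rewrite ?sub0e ?sube0 ?oppr0// (@le_anti _ _ c 0) ?c0 ?c0'.
Qed.

Lemma measurable_ler (c : R) : measurable [set u : R | u <= c].
Proof.
have -> : [set u : R | u <= c] = `]-oo, c]%classic.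
  by apply/seteqP; split=> u /=; rewrite in_itv.
exact: measurable_itv.
Qed.

End uniform.

(** * The chain killed when somebody stops *)

Section alive.
Context (R : realType) (N : nat) (d : measure_display) (T : measurableType d).
Context (S : chain R N T).
Local Notation strategy := {ptws 'I_N -> R}.
Implicit Types (x y z : 'I_N) (w : T) (q : strategy) (pi : nat -> strategy).

Definition trans x y : R := fine (law S x [set w | X S 1 w = y]).

Lemma transE x y : law S x [set w | X S 1 w = y] = (trans x y)%:E.
Proof. by rewrite fineK// fin_num_measure//; exact: measurable_X. Qed.

Lemma trans_ge0 x y : 0 <= trans x y.
Proof. exact: fine_ge0. Qed.

Lemma sum_trans x : \sum_y trans x y = 1.
Proof.
apply: EFin_inj; rewrite -sumEFin -(@probability_setT _ _ _ (law S x)).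
rewrite (probability_fibers (f := X S 1)); last first.
  by move=> y; rewrite setTI; exact: measurable_X.
apply: eq_bigr => y _; rewrite setTI. exact: esym (transE _ _).
Qed.

Lemma law_Y x t (c : R) : 0 <= c <= 1 ->
  law S x (Y S t @^-1` [set u | u <= c]) = c%:E.
Proof.
by move=> c01; rewrite Y_uniform ?uniform_prob_le//; exact: measurable_ler.
Qed.

Lemma law_Y' x t (c : R) : 0 <= c <= 1 ->
  law S x (Y' S t @^-1` [set u | u <= c]) = c%:E.
Proof.
by move=> c01; rewrite Y'_uniform ?uniform_prob_le//; exact: measurable_ler.
Qed.

Lemma measurable_preY t (A : set R) : measurable A -> measurable (Y S t @^-1` A).
Proof. by move=> mA; rewrite -[X in measurable X]setTI; exact: measurable_Y. Qed.

Lemma measurable_preY' t (A : set R) : measurable A -> measurable (Y' S t @^-1` A).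
Proof. by move=> mA; rewrite -[X in measurable X]setTI; exact: measurable_Y'. Qed.

Lemma measurable_preX t (C : set 'I_N) : measurable (X S t @^-1` C).
Proof.
apply: (measurable_fibers (f := X S t)) => y.
have [Cy|nCy] := pselect (C y).
  rewrite (_ : _ `&` _ = [set w | X S t w = y]); first exact: measurable_X.
  by apply/seteqP; split=> w /=; [case|move=> H; rewrite H; split].
rewrite (_ : _ `&` _ = set0)//.
by apply/seteqP; split=> w //= [Cw Xw]; apply: nCy; rewrite -Xw.
Qed.

Lemma law_YC x t (c : R) : 0 <= c <= 1 ->
  law S x (Y S t @^-1` (~` [set u | u <= c])) = (1 - c)%:E.
Proof.
move=> c01; rewrite preimage_setC probability_setC ?law_Y//.
exact: (measurable_preY t (measurable_ler c)).
Qed.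

Lemma law_Y'C x t (c : R) : 0 <= c <= 1 ->
  law S x (Y' S t @^-1` (~` [set u | u <= c])) = (1 - c)%:E.
Proof.
move=> c01; rewrite preimage_setC probability_setC ?law_Y'//.
exact: (measurable_preY' t (measurable_ler c)).
Qed.

Lemma measurable_cylinder n (C : nat -> set 'I_N) (A A' : nat -> set R) :
  (forall t, measurable (A t)) -> (forall t, measurable (A' t)) ->
  measurable [set w | forall t, (t < n)%N ->
                [/\ C t (X S t w), A t (Y S t w) & A' t (Y' S t w)]].
Proof.
move=> mA mA'.
rewrite (_ : mkset _ = \bigcap_(t in `I_n)
  (X S t @^-1` C t `&` (Y S t @^-1` A t `&` Y' S t @^-1` A' t))); last first.
  by apply/seteqP; split=> w H t /H => [[]|[? []]].
apply: bigcap_measurableType => t _.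
apply: measurableI; first exact: measurable_preX.
by apply: measurableI; [exact: measurable_preY|exact: measurable_preY'].
Qed.

Section path_decomposition.
Context (pi : nat -> strategy) (q : strategy).

(** Nobody stops before date [t]. The component [r] of the follower's strategy does not occur, since
    the follower uses [q] as long as the leader continues. *)
Definition alive t w : bool :=
  [forall k : 'I_t, (pi k (X S k w) < Y S k w) && (q (X S k w) < Y' S k w)].

Lemma aliveP t w : reflect
  (forall k, (k < t)%N -> pi k (X S k w) < Y S k w /\ q (X S k w) < Y' S k w)
  (alive t w).
Proof.
apply: (iffP forallP) => [H k kt|H k]; first exact/andP/(H (Ordinal kt)).
exact/andP/H.
Qed.

(** [U] and [U'] prescribe what happens at date [t]. The next state is recorded so that the
    transition out of [z] can be split off. *)
Definition alive_event t z (U U' : set R) y : set T :=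
  [set w | [/\ alive t w, X S t w = z, U (Y S t w), U' (Y' S t w)
             & X S t.+1 w = y]].

Let path t w : {ffun 'I_t.+1 -> 'I_N} := [ffun k : 'I_t.+1 => X S k w].

(* On a fixed path of the chain, [alive_event] is a product event, to which    *)
(* [XYY'_indep] applies.                                                       *)
Let cyl t (s : {ffun 'I_t.+1 -> 'I_N}) (U U' : set R) y : set T :=
  [set w | forall k, (k < t.+2)%N ->
     [/\ (if (k <= t)%N then [set s (inord k)] else [set y]) (X S k w),
         (if (k < t)%N then [set u | pi k (s (inord k)) < u]
          else if k == t then U else setT) (Y S k w) &
         (if (k < t)%N then [set u | q (s (inord k)) < u]
          else if k == t then U' else setT) (Y' S k w)]].

Let alive_event_path t z U U' y s :
  alive_event t z U U' y `&` [set w | path t w = s] =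
  if s ord_max == z then cyl s U U' y else set0.
Proof.
have pathE w : path t w = s <-> forall k, (k <= t)%N -> X S k w = s (inord k).
  split=> [<- k kt|H]; first by rewrite ffunE inordK.
  by apply/ffunP => k; rewrite ffunE H ?inord_val// -ltnS.
have inmax : inord t = ord_max :> 'I_t.+1 by apply: val_inj; rewrite /= inordK.
case: eqP => [sz|nsz]; last first.
  apply/seteqP; split=> w //= [[_ Xz _ _ _]] /pathE/(_ t (leqnn _)).
  by rewrite Xz inmax => /esym.
apply/seteqP; split=> w /=.
  move=> [[/aliveP al Xz UY UY' Xy] /pathE H] k kt.
  have [kt'|kt'] := ltnP k t.
    have kt2 := ltnW kt'; rewrite kt2/= -H//.
    by have [? ?] := al _ kt'.
  have [kEt|kNt] := eqVneq k t; first by subst k; rewrite leqnn/= -H.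
  have -> : k = t.+1 by lia.
  by rewrite ltnn.
move=> H; have Hp : path t w = s.
  by apply/pathE => k kt; have [] := H k; rewrite ?kt//; lia.
split=> //; split.
- apply/aliveP => k kt; have [|] := H k; first lia.
  by rewrite kt (ltnW kt)/= => ->.
- by rewrite -sz -Hp ffunE.
- by have [|_] := H t; [lia|rewrite ltnn eqxx].
- by have [|_ _] := H t; [lia|rewrite ltnn eqxx].
- by have [|] := H t.+1; [lia|rewrite ltnn].
Qed.

Let measurable_gtr (c : R) : measurable [set u : R | c < u].
Proof.
have -> : [set u : R | c < u] = `]c, +oo[%classic.
  by apply/seteqP; split=> u /=; rewrite in_itv/= andbT.
exact: measurable_itv.
Qed.

Let measurable_cyl t s U U' y : measurable U -> measurable U' ->
  measurable (@cyl t s U U' y).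
Proof.
move=> mU mU'; apply: (@measurable_cylinder t.+2
  (fun k => if (k <= t)%N then [set s (inord k)] else [set y])
  (fun k => if (k < t)%N then [set u | pi k (s (inord k)) < u]
          else if k == t then U else setT)
  (fun k => if (k < t)%N then [set u | q (s (inord k)) < u]
          else if k == t then U' else setT)) => k;
  by case: ifP => _ //; case: ifP.
Qed.

(** The probability, in product form, that the chain follows [s] up to date [t] and nobody stops
    before [t]. *)
Let base x t (s : {ffun 'I_t.+1 -> 'I_N}) : \bar R :=
  (law S x [set w | forall k, (k <= t)%N -> X S k w = s (inord k)] *
   (\prod_(k < t) law S x (Y S k @^-1` [set u | (pi k (s (inord k)) < u)%R])) *
   (\prod_(k < t) law S x (Y' S k @^-1` [set u | (q (s (inord k)) < u)%R])))%E.

Let base_ge0 x t s : (0 <= @base x t s)%E.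
Proof. by rewrite !mule_ge0// prode_ge0. Qed.

(** Independence separates the chain from the uniforms: dates before [t] contribute to [base], date
    [t] contributes [U] and [U'], and date [t.+1] constrains the chain only, whose last transition
    comes off by the Markov property. *)
Let law_cyl x t s U U' y : measurable U -> measurable U' ->
  law S x (@cyl t s U U' y) =
  (base x s * (law S x (Y S t @^-1` U) * law S x (Y' S t @^-1` U') *
   (trans (s ord_max) y)%:E))%E.
Proof.
move=> mU mU'; rewrite [LHS](@XYY'_indep _ _ _ _ S x t.+2
  (fun k => if (k <= t)%N then [set s (inord k)] else [set y])
  (fun k => if (k < t)%N then [set u | pi k (s (inord k)) < u]
          else if k == t then U else setT)
  (fun k => if (k < t)%N then [set u | q (s (inord k)) < u]
          else if k == t then U' else setT)); last 2 first.
- by move=> k; case: ifP => _ //; case: ifP.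
- by move=> k; case: ifP => _ //; case: ifP.
rewrite !big_ord_recr/= !ltnn eqxx ltnNge leqnSn/= gtn_eqF//.
rewrite !preimage_setT !probability_setT !mule1.
under eq_bigr => k _ do rewrite ltn_ord.
under [X in (_ * _ * (X * _))%E]eq_bigr => k _ do rewrite ltn_ord.
rewrite [X in (X * _ * _)%E](_ : _ =
    (law S x [set w | forall k, (k <= t)%N -> X S k w = s (inord k)] *
     (trans (s ord_max) y)%:E)%E); last first.
  have inmax : inord t = ord_max :> 'I_t.+1 by apply: val_inj; rewrite /= inordK.
  rewrite -transE -inmax -(X_markov S x t (fun k => s (inord k))).
  congr (law S x _); apply/seteqP; split=> w /=.
    move=> H; split=> [k kt|]; first by have := H k; rewrite kt; apply; lia.
    by have := H t.+1; rewrite ltnn; apply.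
  move=> [H Hy] k kt; case: ifPn => [/H//|kt'].
  by have -> : k = t.+1 by lia.
rewrite /base -!muleA; congr (_ * _)%E; rewrite muleC -!muleA.
by congr (_ * _)%E; rewrite muleCA.
Qed.

Lemma measurable_alive_event t z U U' y : measurable U -> measurable U' ->
  measurable (alive_event t z U U' y).
Proof.
move=> mU mU'; apply: (measurable_fibers (f := path t)) => s.
by rewrite alive_event_path; case: ifP => _ //; exact: measurable_cyl.
Qed.

Let law_alive_event_base x t z U U' y : measurable U -> measurable U' ->
  law S x (alive_event t z U U' y) =
  ((\sum_(s : {ffun 'I_t.+1 -> 'I_N} | s ord_max == z) base x s) *
   (law S x (Y S t @^-1` U) * law S x (Y' S t @^-1` U') * (trans z y)%:E))%E.
Proof.
move=> mU mU'; rewrite (probability_fibers (f := path t)); last first.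
  move=> s; rewrite alive_event_path.
  by case: ifP => _ //; exact: measurable_cyl.
rewrite ge0_sume_distrl// [RHS]big_mkcond; apply: eq_bigr => s _.
rewrite alive_event_path; case: eqP => [<-|_]; last by rewrite measure0.
exact: law_cyl.
Qed.

Lemma measurable_alive t z U U' : measurable U -> measurable U' ->
  measurable [set w | [/\ alive t w, X S t w = z, U (Y S t w) & U' (Y' S t w)]].
Proof.
move=> mU mU'; apply: (measurable_fibers (f := X S t.+1)) => y.
rewrite (_ : _ `&` _ = alive_event t z U U' y); first exact: measurable_alive_event.
by apply/seteqP; split=> w /=; [case=> -[]|case].
Qed.

Let law_alive_base x t z U U' : measurable U -> measurable U' ->
  law S x [set w | [/\ alive t w, X S t w = z, U (Y S t w) & U' (Y' S t w)]] =
  ((\sum_(s : {ffun 'I_t.+1 -> 'I_N} | s ord_max == z) base x s) *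
   (law S x (Y S t @^-1` U) * law S x (Y' S t @^-1` U')))%E.
Proof.
move=> mU mU'.
have eventE y : [set w | [/\ alive t w, X S t w = z, U (Y S t w)
    & U' (Y' S t w)]] `&` [set w | X S t.+1 w = y] = alive_event t z U U' y.
  by apply/seteqP; split=> w /=; [case=> -[]|case].
rewrite (probability_fibers (f := X S t.+1)); last first.
  by move=> y; rewrite eventE; exact: measurable_alive_event.
under eq_bigr => y _ do rewrite eventE law_alive_event_base// muleA.
rewrite -ge0_sume_distrr; last by move=> y _; rewrite lee_fin trans_ge0.
by rewrite sumEFin sum_trans mule1.
Qed.

(** The sub-probability law at date [t] of the chain killed once somebody has stopped. *)
Definition reach x t z : R := fine (law S x [set w | alive t w /\ X S t w = z]).

Let reach_base x t z :
  (reach x t z)%:E = (\sum_(s : {ffun 'I_t.+1 -> 'I_N} | s ord_max == z) base x s)%E.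
Proof.
have aliveE : [set w | alive t w /\ X S t w = z] =
    [set w | [/\ alive t w, X S t w = z, setT (Y S t w) & setT (Y' S t w)]].
  by apply/seteqP; split=> w /=; [case|case].
rewrite fineK; last first.
  by apply: fin_num_measure; rewrite aliveE; exact: measurable_alive.
by rewrite aliveE law_alive_base// !preimage_setT !probability_setT !mule1.
Qed.

Lemma law_alive x t z U U' : measurable U -> measurable U' ->
  law S x [set w | [/\ alive t w, X S t w = z, U (Y S t w) & U' (Y' S t w)]] =
  ((reach x t z)%:E * (law S x (Y S t @^-1` U) * law S x (Y' S t @^-1` U')))%E.
Proof. by move=> mU mU'; rewrite law_alive_base// reach_base. Qed.

Lemma reach0 x z : reach x 0 z = (x == z)%:R.
Proof.
rewrite /reach; have aliveE : [set w | alive 0 w /\ X S 0 w = z] =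
    [set w | X S 0 w = z].
  by apply/seteqP; split=> w /=; [case|move=> ?; split=> //; apply/aliveP].
rewrite aliveE; case: eqP => [->|xz]; first by rewrite X_start.
suff -> : law S x [set w | X S 0 w = z] = 0%E by [].
apply/eqP; rewrite eq_le measure_ge0 andbT.
have /(congr1 (fun r => 1 - r)%E) := X_start S x.
rewrite -probability_setC; last exact: measurable_X.
rewrite subee// => <-; apply: le_measure; rewrite ?inE.
- exact: measurable_X.
- by apply: measurableC; exact: measurable_X.
- by move=> w /= -> /esym.
Qed.

(** Forward equation: surviving date [t] in state [z] means that both uniforms exceed their
    thresholds, after which the chain moves. *)
Lemma reachS x t y : (forall k, R0 (pi k)) -> R0 q ->
  reach x t.+1 y =
  \sum_z reach x t z * ((1 - pi t z) * (1 - q z)) * trans z y.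
Proof.
move=> pi01 q01; apply: EFin_inj; rewrite -sumEFin fineK; last first.
  apply: fin_num_measure.
  rewrite (_ : mkset _ = [set w | [/\ alive t.+1 w, X S t.+1 w = y, setT (Y S t.+1 w)
    & setT (Y' S t.+1 w)]]); first exact: measurable_alive.
  by apply/seteqP; split=> w /=; [case|case].
have eventE z : [set w | alive t.+1 w /\ X S t.+1 w = y] `&` [set w | X S t w = z]
    = alive_event t z (~` [set u | u <= pi t z]) (~` [set u | u <= q z]) y.
  apply/seteqP; split=> w /=.
    move=> [[/aliveP al Xy] Xz]; have [piY qY] := al t (ltnSn t).
    rewrite Xz in piY qY; split=> //; first 1 last.
    - by apply/negP; rewrite -ltNge.
    - by apply/negP; rewrite -ltNge.
    by apply/aliveP => k kt; apply: al; exact: ltnW.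
  move=> [/aliveP al Xz /negP piY /negP qY Xy]; split=> //; split=> //.
  apply/aliveP => k; rewrite ltnS leq_eqVlt => /predU1P[->|/al//].
  by rewrite Xz !ltNge.
have mC (c : R) : measurable (~` [set u : R | u <= c]).
  by apply: measurableC; exact: measurable_ler.
rewrite (probability_fibers (f := X S t)); last first.
  by move=> z; rewrite eventE; exact: measurable_alive_event.
apply: eq_bigr => z _; rewrite eventE law_alive_event_base// -reach_base.
by rewrite (law_YC _ _ (pi01 t z)) (law_Y'C _ _ (q01 z)) -!EFinM mulrA.
Qed.

End path_decomposition.
End alive.

(** * First hitting dates as extended reals *)

Section first_time.
Context (R : realType).

Variant first_time_spec (A : set nat) : \bar R -> Prop :=
| FirstTimeNone of (forall t, ~ A t) : first_time_spec A +oo%E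
| FirstTime t of A t & (forall k, (k < t)%N -> ~ A k) : first_time_spec A t%:R%:E.

Lemma first_timeP (A : set nat) : first_time_spec A (first_time R A).
Proof.
have [[t At]|nA] := pselect (exists t, A t); last first.
  have -> : first_time R A = +oo%E.
    rewrite /first_time (_ : image _ _ = set0) ?ereal_inf0//.
    by apply/seteqP; split=> // y [t At _]; case: nA; exists t.
  by constructor=> t At; apply: nA; exists t.
have eA : exists t, `[< A t >] by exists t; apply/asboolP.
case: (ex_minnP eA) => m /asboolP Am mmin.
have -> : first_time R A = m%:R%:E.
  apply/eqP; rewrite eq_le; apply/andP; split.
    by apply: ereal_inf_lbound; exists m.
  apply: le_ereal_inf_tmp => _ [k Ak <-]; rewrite lee_fin ler_nat.
  by apply: mmin; apply/asboolP.
constructor=> // k km Ak; have /mmin : `[< A k >] by apply/asboolP.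
by rewrite leqNgt km.
Qed.

Lemma first_time_eq (A : set nat) t : A t -> (forall k, (k < t)%N -> ~ A k) ->
  first_time R A = t%:R%:E.
Proof.
move=> At lt; case: first_timeP => [/(_ t)//|k Ak ltk].
by case: (ltngtP k t) => [/lt|/ltk|->].
Qed.

Lemma first_time_gt (A : set nat) t : (forall k, (k <= t)%N -> ~ A k) ->
  (t%:R%:E < first_time R A)%E.
Proof.
move=> lt; case: first_timeP => [_|k Ak _]; first exact: ltry.
by rewrite lte_fin ltr_nat ltnNge; apply/negP => /lt.
Qed.

Lemma first_time_pinfty (A : set nat) : (forall t, ~ A t) ->
  first_time R A = +oo%E.
Proof. by move=> nA; case: first_timeP => // t /nA. Qed.

Lemma step_nat (t : nat) : step (t%:R%:E : \bar R) = t.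
Proof. by apply: truncn_def; rewrite lexx ltr_nat ltnSn. Qed.

Lemma discount_nat (dl : R) (t : nat) : discount dl t%:R%:E = dl ^+ t.
Proof. by rewrite /discount step_nat. Qed.

End first_time.

Section payoff_bound.
Context (R : realType) (N : nat) (A B C : 'I_N -> R).

Definition payoff_bound : R := \sum_y (`|A y| + `|B y| + `|C y|).

Lemma le_payoff_bound y :
  [/\ `|A y| <= payoff_bound, `|B y| <= payoff_bound & `|C y| <= payoff_bound].
Proof.
have : `|A y| + `|B y| + `|C y| <= payoff_bound.
  by rewrite /payoff_bound (bigD1 y)//= lerDl sumr_ge0.
have := normr_ge0 (A y); have := normr_ge0 (B y); have := normr_ge0 (C y).
by split; lra.
Qed.

Lemma payoff_bound_ge0 : 0 <= payoff_bound.
Proof. by apply: sumr_ge0 => y _; rewrite !addr_ge0. Qed.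

End payoff_bound.

(** * Values as discounted sums of stage payoffs *)

Section stage_payoff.
Context (R : realType) (N : nat) (d : measure_display) (T : measurableType d).
Context (S : chain R N T).
Local Notation strategy := {ptws 'I_N -> R}.
Implicit Types (x y z : 'I_N) (w : T) (pi : nat -> strategy).

(** Backward equation, obtained from the forward one by induction. The Bellman equation needs the
    first step isolated, not the last. *)
Lemma reachS_front pi (q : strategy) x t y : (forall k, R0 (pi k)) -> R0 q ->
  reach S pi q x t.+1 y = (1 - pi 0%N x) * (1 - q x) *
    \sum_z trans S x z * reach S (fun k => pi k.+1) q z t y.
Proof.
move=> pi01 q01; elim: t y => [|t IH] y.
  rewrite reachS// (bigD1 x)//= reach0 eqxx mul1r big1 ?addr0; last first.
    by move=> z zx; rewrite reach0 eq_sym (negbTE zx) !mul0r.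
  congr (_ * _); rewrite (bigD1 y)//= reach0 eqxx mulr1 big1 ?addr0//.
  by move=> z zy; rewrite reach0 (negbTE zy) mulr0.
rewrite reachS//; under eq_bigr => z _ do rewrite IH.
under [in RHS]eq_bigr => z _ do rewrite reachS// mulr_sumr.
rewrite [in RHS]exchange_big/= mulr_sumr; apply: eq_bigr => z _.
rewrite -!mulrA; congr (_ * (_ * _)).
by rewrite !mulr_suml; apply: eq_bigr => u _; rewrite !mulrA.
Qed.

Context (dl : R) (A B C : 'I_N -> R) (r q : strategy).
Hypotheses (dl01 : 0 < dl < 1) (r01 : R0 r) (q01 : R0 q).

(* [A] is paid if the leader stops first, [B] if the follower stops first, [C] *)
(* if they stop together.                                                      *)
Definition stop_payoff pi w : R :=
  let s := tau1 S pi w in let s' := tau2 S pi (r, q) w in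
  discount dl (mine s s') *
    (A (X S (step s) w) * (s < s')%E%:R + B (X S (step s') w) * (s' < s)%E%:R +
     C (X S (step s) w) * (s' == s)%:R).

Definition stop_value pi x : R := fine (\int[law S x]_w (stop_payoff pi w)%:E)%E.

(* [o] tells whether the leader and whether the follower stops.                *)
Definition outcome y (o : bool * bool) : R :=
  match o with
  | (true, true) => C y | (true, false) => A y
  | (false, true) => B y | (false, false) => 0
  end.

(** If nobody stopped earlier, [tau1 <= t] holds exactly when the leader stops at [t], so the
    threshold in [tau2] is decided by the leader's action at the same date. *)
Definition stage_outcome pi t w : bool * bool :=
  let y := X S t w in let l := Y S t w <= pi t y in
  (l, Y' S t w <= if l then r y else q y).

Definition stage_payoff pi t w : R :=
  (alive S pi q t w)%:R * outcome (X S t w) (stage_outcome pi t w).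

(** At most one stage payoff is nonzero, namely at the first date where somebody stops. The partial
    sums are thus eventually constant, which gives pointwise convergence. *)
Lemma stop_payoff_stages pi w :
  exists n0, forall n, (n0 <= n)%N ->
    \sum_(t < n) dl ^+ t * stage_payoff pi t w = stop_payoff pi w.
Proof.
pose stop t := (Y S t w <= pi t (X S t w)) || (Y' S t w <= q (X S t w)).
have aliveE t : alive S pi q t w <-> forall k, (k < t)%N -> ~~ stop k.
  split=> [/aliveP al k /al[]|al].
    by rewrite !ltNge negb_or => -> ->.
  by apply/aliveP => k /al; rewrite negb_or -!ltNge => /andP[].
have stage0 t : ~~ stop t -> stage_payoff pi t w = 0.
  rewrite /stage_payoff /stage_outcome negb_or => /andP[/negbTE-> /negbTE->].
  by rewrite mulr0.
have [[t0 st0]|nstop] := pselect (exists t, stop t); last first.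
  have ns t : ~~ stop t by apply/negP => st; apply: nstop; exists t.
  exists 0%N => n _; rewrite big1; last by move=> t _; rewrite stage0// mulr0.
  have t1 : tau1 S pi w = +oo%E.
    by apply: first_time_pinfty => t /= L; have := ns t; rewrite /stop L.
  have t2 : tau2 S pi (r, q) w = +oo%E.
    apply: first_time_pinfty => t /=; rewrite t1 leye_eq/= mulr0 add0r ltry mulr1.
    by move=> L; have := ns t; rewrite /stop L orbT.
  by rewrite /stop_payoff/= t1 t2 minxx /discount eqxx mul0r.
case: (ex_minnP (ex_intro _ t0 st0)) => {t0 st0} t st tmin.
have ns k : (k < t)%N -> ~~ stop k.
  by move=> kt; apply/negP => /tmin; rewrite leqNgt kt.
have alt : alive S pi q t w by apply/aliveE.
exists t.+1 => n tn.
rewrite (bigD1 (Ordinal tn))//= big1 ?addr0; last first.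
  move=> k; rewrite -val_eqE/= => kt; rewrite neq_ltn in kt.
  have {kt} [/ns/stage0->|tk] := orP kt; first by rewrite mulr0.
  rewrite /stage_payoff (negbTE (_ : ~~ alive S pi q k w)) ?mul0r ?mulr0//.
  by apply/negP => /aliveE/(_ _ tk)/negP.
have t1gt k : (k < t)%N -> (k%:R%:E < tau1 S pi w)%E.
  move=> kt; apply: first_time_gt => j jk /=; apply/negP.
  by have := ns j (leq_ltn_trans jk kt); rewrite negb_or => /andP[].
have nY' k : (k < t)%N -> ~ Y' S k w <=
    r (X S k w) * (tau1 S pi w <= k%:R%:E)%E%:R +
    q (X S k w) * (k%:R%:E < tau1 S pi w)%E%:R.
  move=> kt; rewrite [(tau1 S pi w <= _)%E]leNgt t1gt//= mulr0 add0r mulr1.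
  apply/negP.
  by have := ns k kt; rewrite negb_or => /andP[].
rewrite /stage_payoff alt mul1r /stop_payoff/=.
have [L|nL] := boolP (Y S t w <= pi t (X S t w)).
  have t1 : tau1 S pi w = t%:R%:E.
    apply: first_time_eq => // k kt /=; apply/negP.
    by have := ns k kt; rewrite negb_or => /andP[].

  have [F|nF] := boolP (Y' S t w <= r (X S t w)).
    have t2 : tau2 S pi (r, q) w = t%:R%:E.
      by apply: first_time_eq => //=; rewrite t1 lexx ltxx mulr0 mulr1 addr0.
    by rewrite t1 t2 /mine ltxx discount_nat eqxx step_nat !mulr0 !add0r mulr1.
  (* The follower may stop later or never; the payoff depends only on the leader being first. *)
  have t2 : (t%:R%:E < tau2 S pi (r, q) w)%E.
    apply: first_time_gt => k; rewrite leq_eqVlt => /predU1P[->/=|/nY'//].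
    by rewrite t1 lexx ltxx mulr0 mulr1 addr0; exact/negP.
  rewrite t1 /mine t2 discount_nat step_nat mulr1 ltNge (ltW t2) (gt_eqF t2).
  by rewrite !mulr0 !addr0.
have F : Y' S t w <= q (X S t w) by move: st; rewrite /stop (negbTE nL).
have t1 : (t%:R%:E < tau1 S pi w)%E.
  apply: first_time_gt => k.
  rewrite leq_eqVlt => /predU1P[->|kt] /=; apply/negP => //.
  by have := ns k kt; rewrite negb_or => /andP[].
have t2 : tau2 S pi (r, q) w = t%:R%:E.
  apply: first_time_eq => //=.
  by rewrite [(tau1 S pi w <= _)%E]leNgt t1 mulr0 mulr1 add0r.
rewrite F t2 /mine.
rewrite [(tau1 S pi w < _)%E]ltNge (ltW t1) t1 (lt_eqF t1) discount_nat step_nat.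
by rewrite !mulr0 addr0 add0r mulr1.
Qed.

Definition stage_mean (p : strategy) y : R :=
  p y * (r y * C y + (1 - r y) * A y) + (1 - p y) * (q y * B y).

Definition outcome_event pi t (i : 'I_N * (bool * bool)) : set T :=
  [set w | [/\ alive S pi q t w, X S t w = i.1,
     (if i.2.1 then [set u | u <= pi t i.1]
      else ~` [set u | u <= pi t i.1]) (Y S t w) &
     (if i.2.2 then [set u | u <= (if i.2.1 then r i.1 else q i.1)]
      else ~` [set u | u <= (if i.2.1 then r i.1 else q i.1)]) (Y' S t w)]].

Let measurable_side (b : bool) (c : R) :
  measurable (if b then [set u | u <= c] else ~` [set u | u <= c]).
Proof.
by case: b; [|apply: measurableC]; exact: measurable_ler.
Qed.

Lemma measurable_outcome_event pi t i : measurable (outcome_event pi t i).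
Proof. exact: measurable_alive. Qed.

Lemma law_outcome_event pi x t i : (forall k, R0 (pi k)) ->
  law S x (outcome_event pi t i) =
  (reach S pi q x t i.1 *
   ((if i.2.1 then pi t i.1 else 1 - pi t i.1) *
    (let c := if i.2.1 then r i.1 else q i.1 in
     if i.2.2 then c else 1 - c)))%:E.
Proof.
move=> pi01; rewrite law_alive// !EFinM; congr (_ * (_ * _))%E.
  by case: ifP => _; [exact/law_Y/pi01|exact/law_YC/pi01].
have c01 : 0 <= (if i.2.1 then r i.1 else q i.1) <= 1.
  by case: ifP => _; [exact: r01|exact: q01].
by case: i.2.2; [exact: law_Y'|exact: law_Y'C].
Qed.

(** As a finite combination of indicators, the stage payoff is measurable and integrable, and its
    mean follows from [law_outcome_event]. *)
Lemma stage_payoff_indic pi t w : stage_payoff pi t w =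
  \sum_i outcome i.1 i.2 * \1_(outcome_event pi t i) w.
Proof.
rewrite /stage_payoff; set o := stage_outcome pi t w.
have indicE i : \1_(outcome_event pi t i) w =
    (alive S pi q t w && (i == (X S t w, o)))%:R :> R.
  rewrite indicE; congr (_%:R); congr nat_of_bool; apply/idP/idP.
    case: i => y [l f]; rewrite inE => -[/= -> Xy]; subst y => Hl Hf.
    rewrite /o /stage_outcome/= !xpair_eqE eqxx/=.
    have El : l = (Y S t w <= pi t (X S t w)).
      by case: l Hl {Hf} => /= [->//|/negP/negbTE->].
    rewrite -El eqxx/=; apply/eqP.
    by case: f Hf => /= [->//|/negP/negbTE->].
  move=> /andP[al /eqP->]; rewrite inE; split=> //=.
    by case: ifP => //= /negbT/negP.
  by case: (Y' S t w <= _) / boolP => //= /negP.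
rewrite (bigD1 (X S t w, o))//= indicE eqxx andbT big1 ?addr0.
  by rewrite mulrC.
by move=> i /negbTE io; rewrite indicE io andbF mulr0.
Qed.

Lemma measurable_stage_payoff pi t : measurable_fun setT (stage_payoff pi t).
Proof.
rewrite (_ : stage_payoff pi t = fun w =>
  \sum_i outcome i.1 i.2 * \1_(outcome_event pi t i) w); last first.
  by apply/funext => w; exact: stage_payoff_indic.
apply: measurable_sum => i; apply: measurable_realfun.measurable_funM.
  exact: measurable_cst.
by apply: measurable_realfun.measurable_indic; exact: measurable_outcome_event.
Qed.

Let integrable_outcome pi x t i : (law S x).-integrable setT
  (fun w => (outcome i.1 i.2 * \1_(outcome_event pi t i) w)%:E).
Proof.
under eq_fun do rewrite EFinM.
apply: integrableZl => //; apply: integrable_indic => //.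
exact: measurable_outcome_event.
Qed.

Let stage_payoffE pi t : (fun w => (stage_payoff pi t w)%:E) =
  (fun w => \sum_i (outcome i.1 i.2 * \1_(outcome_event pi t i) w)%:E)%E.
Proof. by apply/funext => w; rewrite stage_payoff_indic sumEFin. Qed.

Lemma integrable_stage_payoff pi x t :
  (law S x).-integrable setT (fun w => (stage_payoff pi t w)%:E).
Proof.
rewrite stage_payoffE; apply: integrable_sum => // i _.
exact: integrable_outcome.
Qed.

Lemma integral_stage_payoff pi x t : (forall k, R0 (pi k)) ->
  (\int[law S x]_w (stage_payoff pi t w)%:E)%E =
  (\sum_y reach S pi q x t y * stage_mean (pi t) y)%:E.
Proof.
move=> pi01; rewrite stage_payoffE integral_sum//; last first.
  by move=> i; exact: integrable_outcome.
transitivity (\sum_(i : 'I_N * (bool * bool)) ((outcome i.1 i.2 *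
  (reach S pi q x t i.1 *
   ((if i.2.1 then pi t i.1 else 1 - pi t i.1) *
    (let c := if i.2.1 then r i.1 else q i.1 in
     if i.2.2 then c else 1 - c))))%:E : \bar R))%E.
  apply: eq_bigr => i _; under eq_integral do rewrite EFinM.
  have mO := measurable_outcome_event pi t i.
  rewrite integralZl//; last exact: integrable_indic.
  by rewrite integral_indic// setIT EFinM; congr (_ * _)%E; exact: law_outcome_event.
rewrite sumEFin; congr EFin.
rewrite -(pair_bigA _ (fun y o => outcome y o * (reach S pi q x t y *
   ((if o.1 then pi t y else 1 - pi t y) *
    (let c := if o.1 then r y else q y in if o.2 then c else 1 - c)))))/=.
apply: eq_bigr => y _.
transitivity (\sum_(l : bool) \sum_(f : bool) (outcome y (l, f) *
  (reach S pi q x t y * ((if l then pi t y else 1 - pi t y) *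
    (let c := if l then r y else q y in if f then c else 1 - c))))).
  by rewrite pair_bigA/=; apply: eq_bigr => -[].
by rewrite !big_bool/= /stage_mean; ring.
Qed.

Definition partial_value pi n x : R :=
  \sum_(t < n) dl ^+ t * \sum_y reach S pi q x t y * stage_mean (pi t) y.

Lemma partial_valueS pi n x : (forall k, R0 (pi k)) ->
  partial_value pi n.+1 x = stage_mean (pi 0%N) x +
    dl * ((1 - pi 0%N x) * (1 - q x)) *
    \sum_z trans S x z * partial_value (fun k => pi k.+1) n z.
Proof.
move=> pi01; rewrite /partial_value big_ord_recl/= expr0 mul1r.
congr (_ + _).
  rewrite (bigD1 x)//= reach0 eqxx mul1r big1 ?addr0// => y yx.
  by rewrite reach0 eq_sym (negbTE yx) mul0r.
under [in RHS]eq_bigr => z _ do rewrite mulr_sumr.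
rewrite [in RHS]exchange_big/= mulr_sumr; apply: eq_bigr => t _.
rewrite /bump/= add1n exprS -!mulrA; congr (_ * _).
under eq_bigr => y _ do rewrite reachS_front// -!mulrA mulr_suml.
rewrite -mulr_sumr -mulr_sumr mulrCA; congr (_ * _).
rewrite mulrCA; congr (_ * _).
rewrite exchange_big/= mulr_sumr; apply: eq_bigr => z _.
by rewrite mulrCA; congr (_ * _); rewrite mulr_sumr; apply: eq_bigr => y _; ring.
Qed.

Local Notation M := (payoff_bound A B C).

Let stage_payoff_le pi t w : `|stage_payoff pi t w| <= M.
Proof.
rewrite /stage_payoff normrM; set y := X S t w.
have [leA leB leC] := le_payoff_bound A B C y.
have M0 := payoff_bound_ge0 A B C.
have : `|outcome y (stage_outcome pi t w)| <= M.
  by case: stage_outcome => -[] [] //=; rewrite normr0.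
by case: alive; rewrite ?normr1 ?normr0 ?mul1r ?mul0r.
Qed.

Let partial_payoff pi n w : R := \sum_(t < n) dl ^+ t * stage_payoff pi t w.

Let partial_payoff_le pi n w : `|partial_payoff pi n w| <= M / (1 - dl).
Proof.
have /andP[dl0 dl1] := dl01.
have M0 := payoff_bound_ge0 A B C.
apply: (@le_trans _ _ (M * \sum_(t < n) dl ^+ t)).
  apply: le_trans (ler_norm_sum _ _ _) _; rewrite mulr_sumr.
  apply: ler_sum => t _; rewrite normrM normrX gtr0_norm// mulrC.
  by rewrite ler_wpM2r// exprn_ge0// ltW.
rewrite ler_wpM2l// -[leRHS]mul1r ler_pdivlMr ?subr_gt0// mulrC.
rewrite -[1 - dl]opprB mulNr -subrX1 opprB.
by rewrite lerBlDr lerDl exprn_ge0// ltW.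
Qed.

(** Dominated convergence: the partial payoffs converge pointwise and are dominated by the geometric
    bound [M / (1 - dl)]. *)
Lemma stop_value_cvg pi x : (forall k, R0 (pi k)) ->
  partial_value pi n x @[n --> \oo] --> stop_value pi x.
Proof.
move=> pi01.
have mpartial n : measurable_fun setT (partial_payoff pi n).
  apply: measurable_sum => t; apply: measurable_realfun.measurable_funM.
    exact: measurable_cst.
  exact: measurable_stage_payoff.
have partial_cvg w : partial_payoff pi n w @[n --> \oo] --> stop_payoff pi w.
  have [n0 Hn0] := stop_payoff_stages pi w.
  by apply: cvg_near_cst; exists n0.
have mstop : measurable_fun setT (stop_payoff pi).
  by apply: (measurable_realfun.measurable_fun_cvg mpartial) => w _.
have := @dominated_convergence _ _ _ (law S x) setT measurableT
  (fun n w => (partial_payoff pi n w)%:E) (fun w => (stop_payoff pi w)%:E)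
  (EFin \o cst (M / (1 - dl))).
case.
- by move=> n; exact/measurable_realfun.measurable_EFinP.
- exact/measurable_realfun.measurable_EFinP.
- by apply: aeW => w _; apply: cvg_EFin => //; [near=> n|exact: partial_cvg].
- exact: finite_measure_integrable_cst.
- by apply: aeW => w n _; rewrite /= lee_fin.
move=> istop _; under eq_fun => n.
  rewrite (_ : (\int[law S x]_w _)%E = (partial_value pi n x)%:E); last first.
    rewrite /partial_payoff/= /partial_value -sumEFin.
    under eq_integral do rewrite -sumEFin.
    rewrite integral_sum//; last first.
      move=> t; under eq_fun do rewrite EFinM.
      by apply: integrableZl => //; exact: integrable_stage_payoff.
    apply: eq_bigr => t _; under eq_integral do rewrite EFinM.
    rewrite integralZl//; last exact: integrable_stage_payoff.
    by rewrite integral_stage_payoff.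
  over.
rewrite -[X in _ --> X -> _]fineK; last exact: integrable_fin_num.
by move=> /fine_cvg.
Unshelve. all: by end_near. Qed.

(** The limit of [partial_valueS]. With the strategy shifted on the right, it covers both [always]
    and [first_then]. *)
Lemma stop_value_bellman pi x : (forall k, R0 (pi k)) ->
  stop_value pi x = stage_mean (pi 0%N) x +
    dl * ((1 - pi 0%N x) * (1 - q x)) *
    \sum_z trans S x z * stop_value (fun k => pi k.+1) z.
Proof.
move=> pi01; apply: (@cvg_unique R (@Rhausdorff R)
  (partial_value pi n.+1 x @[n --> \oo])).
  have := stop_value_cvg (x := x) pi01.
  by rewrite -(@cvg_shiftS R (fun n => partial_value pi n x)).
rewrite /= (_ : (fun n => partial_value pi n.+1 x) = fun n =>
    stage_mean (pi 0%N) x + dl * ((1 - pi 0%N x) * (1 - q x)) *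
    \sum_z trans S x z * partial_value (fun k => pi k.+1) n z); last first.
  by apply/funext => n; exact: partial_valueS.
apply: cvgD; first exact: cvg_cst.
apply: cvgMl_tmp; apply: cvg_big => //; first exact: add_continuous.
by move=> z _; apply: cvgMl_tmp; apply: stop_value_cvg => k; exact: pi01.
Qed.

End stage_payoff.

(** * The Bellman operator: comparison, uniqueness and bounds *)

Section bellman.
Context (R : realType) (N : nat) (d : measure_display) (T : measurableType d).
Context (S : chain R N T) (dl : R) (A B C : 'I_N -> R).
Hypothesis dl01 : 0 < dl < 1.
Local Notation strategy := {ptws 'I_N -> R}.
Implicit Types (p q r : strategy) (v u : 'I_N -> R) (x y z : 'I_N).

Definition bellman p r q v x : R :=
  stage_mean A B C r q p x +
  dl * ((1 - p x) * (1 - q x)) * \sum_z trans S x z * v z.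

Local Notation value p r q := (stop_value S dl A B C r q (always p)).

Lemma stop_value_always p r q x : R0 p -> R0 r -> R0 q ->
  value p r q x = bellman p r q (value p r q) x.
Proof. by move=> p01 r01 q01; exact: stop_value_bellman. Qed.

Lemma stop_value_first_then p' p r q x : R0 p' -> R0 p -> R0 r -> R0 q ->
  stop_value S dl A B C r q (first_then p' p) x =
  bellman p' r q (value p r q) x.
Proof.
by move=> p'01 p01 r01 q01; apply: stop_value_bellman => // -[].
Qed.

Let continue01 p q x : R0 p -> R0 q -> 0 <= (1 - p x) * (1 - q x) <= 1.
Proof. by move=> /(_ x)/andP[? ?] /(_ x)/andP[? ?]; nra. Qed.

Lemma bellman_mono p r q v u x : R0 p -> R0 q ->
  (forall z, v z <= u z) -> bellman p r q v x <= bellman p r q u x.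
Proof.
move=> p01 q01 vu; have /andP[dl0 _] := dl01.
have /andP[m0 _] := continue01 x p01 q01.
rewrite lerD2l; apply: ler_wpM2l; first by apply: mulr_ge0 => //; exact: ltW.
by apply: ler_sum => z _; rewrite ler_wpM2l ?trans_ge0.
Qed.

(* Maximum principle: at a maximum of [v - u] the hypotheses give              *)
(* [v - u <= dl * (v - u)] if [v - u] is positive.                             *)
Lemma bellman_comparison p r q v u : R0 p -> R0 q ->
  (forall x, v x <= bellman p r q v x) ->
  (forall x, bellman p r q u x <= u x) -> forall x, v x <= u x.
Proof.
move=> p01 q01 vle ule x; have /andP[dl0 dl1] := dl01.
have [x0 _ maxx0] := arg_maxP (fun y => v y - u y) (erefl true : predT x).
rewrite -subr_le0; apply: le_trans (maxx0 x erefl) _.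
set w := v x0 - u x0; rewrite leNgt; apply/negP => w0.
have : w <= dl * ((1 - p x0) * (1 - q x0)) * \sum_z trans S x0 z * (v z - u z).
  apply: le_trans (lerB (vle x0) (ule x0)) _.
  rewrite /bellman opprD addrACA subrr add0r -mulrBr -sumrB.
  by under eq_bigr do rewrite -mulrBr.
have /andP[m0 m1] := continue01 x0 p01 q01.
have sumle : \sum_z trans S x0 z * (v z - u z) <= w.
  apply: (@le_trans _ _ (\sum_z trans S x0 z * w)).
    apply: ler_sum => z _; apply: ler_wpM2l; first exact: trans_ge0.
    exact: maxx0.
  by rewrite -mulr_suml sum_trans mul1r.
move: m0 m1; set m := (1 - _) * _ => m0 m1.
have : dl * m * \sum_z trans S x0 z * (v z - u z) <= dl * m * w.
  by apply: ler_wpM2l => //; apply: mulr_ge0 => //; exact: ltW.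
have dm : dl * m <= dl by rewrite -[leRHS]mulr1 ler_wpM2l ?(ltW dl0).
nra.
Qed.

Lemma bellman_unique p r q v : R0 p -> R0 r -> R0 q ->
  (forall x, v x = bellman p r q v x) -> forall x, v x = value p r q x.
Proof.
move=> p01 r01 q01 vE x; apply/eqP; rewrite eq_le.
have VE y := stop_value_always y p01 r01 q01.
by apply/andP; split; apply: (bellman_comparison (r := r) p01 q01) => y;
  rewrite -?VE -?vE.
Qed.

Local Notation bound := (payoff_bound A B C).

(** The constants [bound] and [- bound] are a super- and a subsolution, between which
    [bellman_comparison] traps the value. The weights in [stage_mean] add up to [1 - m], where [m]
    is the probability [(1 - p x) * (1 - q x)] of continuing. *)
Lemma bellman_bound p r q x : R0 p -> R0 r -> R0 q ->
  bellman p r q (fun=> bound) x <= bound /\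
  - bound <= bellman p r q (fun=> - bound) x.
Proof.
move=> p01 r01 q01; have /andP[dl0 dl1] := dl01.
set K := bound; have K0 : 0 <= K := payoff_bound_ge0 A B C.
rewrite /bellman -!mulr_suml sum_trans !mul1r mulrN.
have discK : dl * ((1 - p x) * (1 - q x)) * K <= K * ((1 - p x) * (1 - q x)).
  have /andP[m0 _] := continue01 x p01 q01.
  rewrite [leRHS]mulrC ler_wpM2r// -[leRHS]mul1r ler_wpM2r//.
  exact: ltW.
have [] := le_payoff_bound A B C x; rewrite -/K !ler_norml.
move=> /andP[A1 A2] /andP[B1 B2] /andP[C1 C2].
have /andP[p0 p1] := p01 x; have /andP[q0 q1] := q01 x.
have /andP[r0 r1] := r01 x; rewrite /stage_mean.
have /andP[X1 X1'] : - K <= r x * C x + (1 - r x) * A x <= K.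
  by apply/andP; split; nra.
have /andP[X2 X2'] : - (q x * K) <= q x * B x <= q x * K.
  by apply/andP; split; nra.
have np0 : 0 <= 1 - p x by rewrite subr_ge0.
have := ler_wpM2l p0 X1; have := ler_wpM2l p0 X1'.
have := ler_wpM2l np0 X2; have := ler_wpM2l np0 X2'.
by split; lra.
Qed.

Lemma stop_value_bounded p r q x : R0 p -> R0 r -> R0 q ->
  `|value p r q x| <= bound.
Proof.
move=> p01 r01 q01; have VE y := stop_value_always y p01 r01 q01.
rewrite ler_norml; apply/andP; split.
- apply: (bellman_comparison (r := r) (v := fun=> - bound) p01 q01) => y.
    by have [] := bellman_bound y p01 r01 q01.
  by rewrite -VE.
- apply: (bellman_comparison (r := r) (u := fun=> bound) p01 q01) => y.
    by rewrite -VE.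
  by have [] := bellman_bound y p01 r01 q01.
Qed.

End bellman.

(** * Limits along an ultrafilter *)

Section ultrafilter_limits.
Context (R : realType) (U : set_system nat) {UU : UltraFilter U}.

Lemma bounded_ultra_cvg (a b : R) (u : nat -> R) :
  (forall n, a <= u n <= b) -> exists2 l, a <= l <= b & u n @[n --> U] --> l.
Proof.
move=> ub.
have [|l [+ lcl]] := @segment_compact R a b (u @ U) (fmap_proper_filter u _).
  by apply: (@filterE _ U) => n; rewrite /= in_itv; exact: ub.
rewrite /= in_itv/= => lab; exists l => // V Vl.
(* A cluster point is a limit for an ultrafilter: otherwise the complement of the neighbourhood [V]
   would have its preimage in [U], yet would have to meet [V]. *)
have [//|UC] := in_ultra_setVsetC (u @^-1` V) UU.
by have [y [/=]] := lcl (~` V) V UC Vl.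
Qed.

Context (N : nat) (d : measure_display) (T : measurableType d).
Context (S : chain R N T) (dl : R) (A B C : 'I_N -> R).
Hypothesis dl01 : 0 < dl < 1.
Local Notation strategy := {ptws 'I_N -> R}.
Context (p r q : nat -> strategy) (ps rs qs : strategy).
Hypotheses (p01 : forall n, R0 (p n)) (r01 : forall n, R0 (r n))
  (q01 : forall n, R0 (q n)).
Hypotheses (ps01 : R0 ps) (rs01 : R0 rs) (qs01 : R0 qs).
Hypotheses (pcvg : forall x, (fun n => p n x : R) @ U --> (ps x : R))
  (rcvg : forall x, (fun n => r n x : R) @ U --> (rs x : R))
  (qcvg : forall x, (fun n => q n x : R) @ U --> (qs x : R)).

Lemma bellman_cvg (v : nat -> 'I_N -> R) (vs : 'I_N -> R) x :
  (forall z, v n z @[n --> U] --> vs z) ->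
  bellman S dl A B C (p n) (r n) (q n) (v n) x @[n --> U] -->
  bellman S dl A B C ps rs qs vs x.
Proof.
move=> vcvg.
have pC y : (fun n => 1 - p n y : R) @ U --> (1 - ps y : R).
  by apply: cvgB; [exact: cvg_cst|exact: pcvg].
have qC y : (fun n => 1 - q n y : R) @ U --> (1 - qs y : R).
  by apply: cvgB; [exact: cvg_cst|exact: qcvg].
have rC y : (fun n => 1 - r n y : R) @ U --> (1 - rs y : R).
  by apply: cvgB; [exact: cvg_cst|exact: rcvg].
rewrite /bellman /stage_mean; apply: cvgD.
  apply: cvgD; apply: cvgM; [exact: pcvg| |exact: pC|].
    by apply: cvgD; apply: cvgMr_tmp; [exact: rcvg|exact: rC].
  by apply: cvgMr_tmp; exact: qcvg.
apply: cvgM; first by apply: cvgMl_tmp; apply: cvgM.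
apply: cvg_big => //; first exact: add_continuous.
by move=> z _; apply: cvgMl_tmp.
Qed.

(** The values are uniformly bounded, hence have limits [vs]. These solve the limiting Bellman
    equation, whose only solution is the value of the limiting strategies. *)
Lemma stop_value_ultra_cvg x :
  stop_value S dl A B C (r n) (q n) (always (p n)) x @[n --> U] -->
  stop_value S dl A B C rs qs (always ps) x.
Proof.
have /choice[vs vcvg] : forall z, exists l : R,
    stop_value S dl A B C (r n) (q n) (always (p n)) z @[n --> U] --> l.
  move=> z.
  have [|l _ ?] := @bounded_ultra_cvg (- payoff_bound A B C) (payoff_bound A B C)
    (fun n => stop_value S dl A B C (r n) (q n) (always (p n)) z); last by exists l.
  by move=> n; rewrite -ler_norml; exact: stop_value_bounded.
rewrite -(@bellman_unique _ _ _ _ S dl A B C dl01 ps rs qs vs)// => y.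
apply: (@cvg_unique R (@Rhausdorff R)) (vcvg y) _.
rewrite /= (_ : (fun n => _) = (fun n => bellman S dl A B C (p n) (r n) (q n)
  (stop_value S dl A B C (r n) (q n) (always (p n))) y)); last first.
  by apply/funext => n; exact: stop_value_always.
exact: bellman_cvg.
Qed.

End ultrafilter_limits.

(** * Entropy and the logistic reply *)

Section entropy_bounds.
Context (R : realType).

Let xlnx (z : R) : 0 <= z <= 1 -> 0 <= - z * ln z <= 1.
Proof.
move=> /andP[z0 z1]; have [->|z_neq0] := eqVneq z 0.
  by rewrite oppr0 mul0r lexx ler01.
have {z0 z_neq0} z_gt0 : 0 < z by rewrite lt_neqAle eq_sym z_neq0.
rewrite mulNr -mulrN; apply/andP; split.
  by rewrite mulr_ge0 ?(ltW z_gt0)// oppr_ge0 ln_le0.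
(* The inequality [ln (1 + y) <= y] at [y = z^-1 - 1]; multiplied by [z], it bounds [- z * ln z] by
   [1 - z]. *)
have lnV : - ln z <= z^-1 - 1.
  rewrite -lnV ?posrE// -[X in ln X](subrK 1) addrC.
  by apply: le_ln1Dx; have := invr_gt0 z; rewrite z_gt0; lra.
have := ler_wpM2l (ltW z_gt0) lnV; rewrite mulrBr mulfV ?gt_eqF//.
lra.
Qed.

(** Each of the two terms is at most 1. The bound is crude, but any constant will do since it gets
    multiplied by [lam n]. *)
Lemma entropy_bounds (z : R) : 0 <= z <= 1 -> 0 <= entropy z <= 2.
Proof.
move=> z01; have /xlnx : 0 <= 1 - z <= 1 by move: z01; lra.
by have := xlnx z01; rewrite /entropy; lra.
Qed.

Lemma logistic_itv (a : R) : 0 <= 1 / (1 + expR a) <= 1.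
Proof.
have := expR_gt0 a => e0; apply/andP; split.
  by rewrite divr_ge0// addr_ge0// ltW.
by rewrite ler_pdivrMr; lra.
Qed.

(* From [x <= 1 + expR x] at [x = a] and at [x = - a].                         *)
Lemma logistic_near_max (h g lam s : R) : 0 < lam -> 0 <= s <= 1 ->
  s * h + (1 - s) * g <=
  1 / (1 + expR ((g - h) / lam)) * h +
  (1 - 1 / (1 + expR ((g - h) / lam))) * g + lam.
Proof.
move=> lam0 /andP[s0 s1].
set a := (g - h) / lam; have e0 := expR_gt0 a.
have gE : g = h + lam * a by rewrite /a mulrC divfK ?gt_eqF// subrKC.
have ra : a <= 1 + expR a by have := expR_ge1Dx a; lra.
have ra' : - a * expR a <= 1 + expR a.
  have : (1 - a) * expR a <= expR (- a) * expR a.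
    by rewrite ler_wpM2r ?(ltW e0)// expR_ge1Dx.
  by rewrite -expRD addNr expR0; nra.
have den : 0 < 1 + expR a by lra.
have -> : 1 - 1 / (1 + expR a) = expR a / (1 + expR a).
  by field; rewrite gt_eqF.
have r1 : 1 / (1 + expR a) * a <= 1 by rewrite mulrAC mul1r ler_pdivrMr ?mul1r.
have r2 : expR a / (1 + expR a) * - a <= 1.
  by rewrite mulrAC ler_pdivrMr ?mul1r// mulrC.
have sumr : 1 / (1 + expR a) + expR a / (1 + expR a) = 1.
  by field; rewrite gt_eqF.
rewrite gE; move: r1 r2 sumr.
set r := 1 / _; set r' := _ / _ => r1 r2 sumr.
have rE : r = 1 - r' by lra.
rewrite rE in r1 *.
suff : lam * ((1 - s) * a) <= lam * (r' * a + 1) by lra.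
rewrite ler_wpM2l ?(ltW lam0)//.
(* The claim is the average of [r1] and [r2] with weights [1 - s] and [s]. *)
have : 0 <= (1 - s) * (1 - (1 - r') * a) by apply: mulr_ge0; lra.
have : 0 <= s * (1 + r' * a) by apply: mulr_ge0; lra.
lra.
Qed.

End entropy_bounds.

(** * The payoffs of the game and the follower's best replies *)

Section game.
Context (R : realType) (N : nat) (d : measure_display) (T : measurableType d).
Context (S : chain R N T) (G : game R N).
Local Notation strategy := {ptws 'I_N -> R}.
Implicit Types (p r q : strategy) (pi : nat -> strategy) (x y z : 'I_N).

Lemma J1E x pi r q : J1 S G x pi (r, q) =
  stop_value S (delta1 G) (f1 G) (g1 G) (h1 G) r q pi x.
Proof. by rewrite /J1 unlock. Qed.

(** The follower receives [g2] when the leader stops first, hence the order [g2], [f2]. The state in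
    the tie term is read at the other stopping time, which coincides when the term counts. *)
Lemma J2E x pi r q : J2 S G x pi (r, q) =
  stop_value S (delta2 G) (g2 G) (f2 G) (h2 G) r q pi x.
Proof.
rewrite /J2 unlock; congr fine; apply: eq_integral => w _; congr EFin.
rewrite /payoff2 /stop_payoff /F2/=; congr (_ * _).
set s := tau1 _ _ _; set s' := tau2 _ _ _ _.
by case: (eqVneq s' s) => [->|_]; rewrite ?mulr0 [f2 _ _ * _ + _]addrC.
Qed.

(** The geometric series of discounted entropies, each at most 2. *)
Definition entropy_bound : R := 2 / (1 - delta2 G).

Let entropy_payoff_bounds pi r q w : R0 r -> R0 q ->
  (0 <= entropy_payoff S G pi (r, q) w <= entropy_bound%:E)%E.
Proof.
move=> r01 q01; have /andP[dl0 dl1] := delta2_itv G.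
rewrite /entropy_payoff; set s := tau1 _ _ _; set s' := tau2 _ _ _ _.
pose e t := q (X S t w) * (t%:R%:E < s)%E%:R + r (X S t w) * (s == t%:R%:E)%:R.
have e01 t : 0 <= e t <= 1.
  rewrite /e; case: ltP => [ts|_].
    by rewrite (gt_eqF ts) mulr1 mulr0 addr0; exact: q01.
  by rewrite mulr0 add0r; case: eqP => _; rewrite ?mulr1 ?mulr0 ?lexx ?ler01.
have term_ge0 t : 0 <= delta2 G ^+ t * entropy (e t).
  have /andP[? _] := entropy_bounds (e01 t).
  by rewrite mulr_ge0// exprn_ge0// ltW.
apply/andP; split.
  by apply: nneseries_ge0 => t _ _; rewrite lee_fin; exact: term_ge0.
apply: lime_le.
  by apply: is_cvg_nneseries => t _ _; rewrite lee_fin; exact: term_ge0.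
apply: nearW => n; rewrite sumEFin lee_fin.
(* Dropping the restriction to dates before somebody stops only adds nonnegative terms. *)
apply: (@le_trans _ _ (\sum_(0 <= t < n) delta2 G ^+ t * entropy (e t))).
  by rewrite [leLHS]big_mkcond; apply: ler_sum => t _; case: ifP.
apply: (@le_trans _ _ (2 * \sum_(t < n) delta2 G ^+ t)).
  rewrite big_mkord mulr_sumr; apply: ler_sum => t _; rewrite mulrC.
  have /andP[_ e2] := entropy_bounds (e01 t).
  by rewrite ler_wpM2r// exprn_ge0// ltW.
rewrite ler_wpM2l// -[leRHS]mul1r ler_pdivlMr ?subr_gt0// mulrC.
rewrite -[1 - delta2 G]opprB mulNr -subrX1 opprB.
by rewrite lerBlDr lerDl exprn_ge0// ltW.
Qed.

Lemma entropy_term_bounds x pi r q : R0 r -> R0 q ->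
  0 <= fine (\int[law S x]_w entropy_payoff S G pi (r, q) w)%E <= entropy_bound.
Proof.
move=> r01 q01.
have H0 w : (0 <= entropy_payoff S G pi (r, q) w)%E.
  by have /andP[] := entropy_payoff_bounds pi w r01 q01.
have I0 : (0 <= \int[law S x]_w entropy_payoff S G pi (r, q) w)%E.
  exact: integral_ge0.
have Ile : (\int[law S x]_w entropy_payoff S G pi (r, q) w <= entropy_bound%:E)%E.
  (* [ge0_le_integral] would require [entropy_payoff] to be measurable *)
  have bound0 : (0 <= entropy_bound%:E :> \bar R)%E.
    (* [T] is inhabited because it carries a probability; the sign of [entropy_bound] is read off at
       a sample point. *)
    have [w _] : exists w : T, True.
      apply: contrapT => nT; have := X_start S x.
      rewrite (_ : mkset _ = set0) ?measure0; last first.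
        by apply/seteqP; split=> // w _; apply: nT; exists w.
      by move=> /eqP; rewrite eqe eq_sym oner_eq0.
    have /andP[] := entropy_payoff_bounds pi w r01 q01.
    exact: le_trans.
  have <- : (\int[law S x]_w (entropy_bound%:E) = entropy_bound%:E)%E.
    rewrite integral_cst// -[RHS]mule1; congr (_ * _)%E.
    exact: probability_setT.
  (* Both integrals are suprema over the simple functions below the integrand, and a larger
     integrand admits more of them. *)
  rewrite !ge0_integralTE//; apply: ereal_sup_le => _ [h hle <-].
  exists h => // w.
  apply: le_trans (hle w) _.
  by have /andP[] := entropy_payoff_bounds pi w r01 q01.
rewrite fine_ge0//= -lee_fin fineK// ge0_fin_numE//.
exact: le_lt_trans Ile (ltry _).
Qed.

(* Policy improvement: maximize the total value over the finitely many pure    *)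
(* replies; at a maximizer, no change of action in a single state can help.    *)
Lemma best_reply_exists p r : R0 p -> R0 r ->
  (forall (x : 'I_N) (s : R), 0 <= s <= 1 ->
     s * h2 G x + (1 - s) * g2 G x <= r x * h2 G x + (1 - r x) * g2 G x) ->
  exists2 q, R0 q & forall x r' q', R0 r' -> R0 q' ->
    J2 S G x (always p) (r', q') <= J2 S G x (always p) (r, q).
Proof.
move=> p01 r01 rmax; have dl01 := delta2_itv G.
pose pure (b : {ffun 'I_N -> bool}) : strategy := fun x => (b x)%:R.
have pure01 b : R0 (pure b).
  by move=> x; rewrite /pure; case: (b x); rewrite ?lexx ler01.
pose V b := stop_value S (delta2 G) (g2 G) (f2 G) (h2 G) r (pure b) (always p).
have VE b x := stop_value_always S (g2 G) (f2 G) (h2 G) dl01 x p01 r01 (pure01 b).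
have [b _ bmax] := arg_maxP (fun b => \sum_x V b x)
  (erefl true : predT ([ffun=> true] : {ffun 'I_N -> bool})).
pose c x := delta2 G * \sum_z trans S x z * V b z.
have bellE r' q' x : bellman S (delta2 G) (g2 G) (f2 G) (h2 G) p r' q' (V b) x =
    p x * (r' x * h2 G x + (1 - r' x) * g2 G x) +
    (1 - p x) * (q' x * f2 G x + (1 - q' x) * c x).
  by rewrite /bellman /stage_mean /c; ring.
have improve x (y : bool) : (1 - p x) * (y%:R * f2 G x + (1 - y%:R) * c x) <=
    (1 - p x) * (pure b x * f2 G x + (1 - pure b x) * c x).
  rewrite leNgt; apply/negP => ylt.
  pose b' : {ffun 'I_N -> bool} := [ffun z => if z == x then y else b z].
  (* Switching to a strictly better action in [x] makes [V b] a subsolution for [b']. Hence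
     [V b <= V b'] everywhere, strictly at [x], against the maximality of the sum. *)
  have Vle z : V b z <=
      bellman S (delta2 G) (g2 G) (f2 G) (h2 G) p r (pure b') (V b) z.
    rewrite {1}/V VE -/(V b) !bellE lerD2l /pure ffunE; case: eqP => [->|//].
    exact: ltW.
  have V'le z : V b z <= V b' z.
    apply: (bellman_comparison dl01 p01 (pure01 b') Vle) => {}z.
    by rewrite {2}/V VE.
  have V'lt : V b x < V b' x.
    rewrite [ltRHS]VE; apply: (@lt_le_trans _ _
      (bellman S (delta2 G) (g2 G) (f2 G) (h2 G) p r (pure b') (V b) x)).
      have -> : V b x =
          bellman S (delta2 G) (g2 G) (f2 G) (h2 G) p r (pure b) (V b) x.
        exact: VE.
      have pb' : pure b' x = y%:R by rewrite /pure ffunE eqxx.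
      by rewrite !bellE ltrD2l pb'.
    exact: bellman_mono.
  have := bmax b' erefl; apply/negP; rewrite -ltNge.
  rewrite (bigD1 x)//= [ltRHS](bigD1 x)//= ltr_leD//.
  by apply: ler_sum => z _.
exists (pure b) => // x r' q' r'01 q'01; rewrite !J2E.
(* [V b] is a supersolution for every reply: [rmax] handles [r'], and [q' y] mixes two pure actions,
   neither of which improves on [b]. *)
apply: (bellman_comparison (r := r') dl01 p01 q'01) => y.
  by rewrite {1}(stop_value_always _ _ _ _ dl01 _ p01 r'01 q'01).
rewrite -/(V b) bellE.
have -> : V b y = bellman S (delta2 G) (g2 G) (f2 G) (h2 G) p r (pure b) (V b) y.
  exact: VE.
rewrite bellE.
have /andP[p0 p1] := p01 y; apply: lerD.
  by rewrite ler_wpM2l// rmax.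
have := improve y true; have := improve y false.
rewrite !mul1r !mul0r subr0 subrr mul0r add0r addr0 mul1r.
by have /andP[q0 q1] := q'01 y; nra.
Qed.

End game.

(** * Convergence in products and cluster points *)

Lemma ptws_cvg (R : realType) (I : eqType) (J : Type) (F : set_system J)
    (u : J -> {ptws I -> R}) (f : {ptws I -> R}) : Filter F ->
  (forall i, (fun j => u j i : R) @ F --> (f i : R)) -> u @ F --> f.
Proof.
move=> FF uf; apply/cvg_sup => i V [W] [[B] oB <-] /= Bf WV.
apply: (filterS (P := [set j | B (u j i)])) (uf i B (open_nbhs_nbhs _)) => //.
by move=> j /WV.
Qed.

Lemma cvg_pair_nbhs (J : Type) (T1 T2 : topologicalType) (F : set_system J)
    (f : J -> T1) (g : J -> T2) (a : T1) (b : T2) : Filter F ->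
  f @ F --> a -> g @ F --> b -> (fun j => (f j, g j)) @ F --> (a, b).
Proof. by move=> FF fa gb; exact: (cvg_pair fa gb). Qed.

Lemma cvg_subfilter_cluster (J : Type) (T : topologicalType)
    (F U : set_system J) (f : J -> T) (l : T) : ProperFilter U ->
  F `<=` U -> f @ U --> l -> cluster (f @ F) l.
Proof.
move=> UU FU fl A B /FU AU /fl BU.
exact: (filter_ex (filterI AU BU)).
Qed.

(** * Optimality inequalities in the regularized game *)

Section equilibrium.
Context (R : realType) (N : nat) (d : measure_display) (T : measurableType d).
Context (S : chain R N T) (G : game R N).
Local Notation strategy := {ptws 'I_N -> R}.
Implicit Types (p r q : strategy) (x : 'I_N) (lam : R).

Let payoff2_bound : R := payoff_bound (g2 G) (f2 G) (h2 G).
Let payoff1_bound : R := payoff_bound (f1 G) (g1 G) (h1 G).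

Lemma r_reg01 lam : R0 (r_reg G lam).
Proof. by move=> x; exact: logistic_itv. Qed.

Lemma q_reg01 lam p : R0 (q_reg S G lam p).
Proof. by move=> x; exact: logistic_itv. Qed.

(** [J2reg] exceeds [J2] by an amount between 0 and [lam * entropy_bound G], so optimality for the
    former is optimality for the latter up to that amount. *)
Lemma regular_equilibrium_reply lam p x r' q' : 0 < lam ->
  regular_equilibrium S G lam p -> R0 r' -> R0 q' ->
  J2 S G x (always p) (r', q') <=
  J2 S G x (always p) (r_reg G lam, q_reg S G lam p) + lam * entropy_bound G.
Proof.
move=> lam0 [p01 /(_ x)[eqS _]] r'01 q'01.
have r01 := r_reg01 lam; have q01 := q_reg01 lam p.
have J2b r q : R0 r -> R0 q -> J2 S G x (always p) (r, q) <= payoff2_bound.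
  move=> ? ?; rewrite J2E; apply: le_trans (ler_norm _) _.
  by apply: stop_value_bounded => //; exact: delta2_itv.
have regle : J2reg S G lam x (always p) (r', q') <=
    J2reg S G lam x (always p) (r_reg G lam, q_reg S G lam p).
  rewrite eqS; apply: ub_le_sup; last by exists (r', q').
  (* A real [sup] dominates the elements of its set only once the set is known to be bounded
     above. *)
  exists (payoff2_bound + lam * entropy_bound G) => _ [[r q] [/= r0 q0] <-].
  rewrite /J2reg lerD ?J2b// ler_wpM2l ?(ltW lam0)//.
  by have /andP[] := entropy_term_bounds S G x (always p) r0 q0.
have /andP[e0 _] := entropy_term_bounds S G x (always p) r'01 q'01.
have /andP[_ e1] := entropy_term_bounds S G x (always p) r01 q01.
have := ler_wpM2l (ltW lam0) e1; have := mulr_ge0 (ltW lam0) e0.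
by move: regle; rewrite /J2reg; lra.
Qed.

Lemma regular_equilibrium_leader lam p x p' :
  regular_equilibrium S G lam p -> R0 p' ->
  J1 S G x (first_then p' p) (r_reg G lam, q_reg S G lam p) <=
  J1 S G x (always p) (r_reg G lam, q_reg S G lam p).
Proof.
move=> [p01 /(_ x)[_ eqS]] p'01; rewrite eqS; apply: ub_le_sup; last by exists p'.
have r01 := r_reg01 lam; have q01 := q_reg01 lam p; have dl01 := delta1_itv G.
exists payoff1_bound => _ [p0 p001 <-]; rewrite J1E stop_value_first_then//.
apply: (@le_trans _ _ (bellman S (delta1 G) (f1 G) (g1 G) (h1 G) p0
    (r_reg G lam) (q_reg S G lam p) (fun=> payoff1_bound) x)).
  apply: bellman_mono => // z; apply: le_trans (ler_norm _) _.
  exact: stop_value_bounded.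
by have [] := bellman_bound S (f1 G) (g1 G) (h1 G) dl01 x p001 r01 q01.
Qed.

End equilibrium.

(** * Passage to the limit *)

Theorem proposition3p30 (R : realType) (N : nat) (d : measure_display)
    (T : measurableType d) (S : chain R N T) (G : game R N)
    (lam : nat -> R) (lam_gt0 : forall n, 0 < lam n)
    (lam_cvg0 : lam @ \oo --> (0 : R))
    (p : nat -> {ptws 'I_N -> R})
    (p_eq : forall n, regular_equilibrium S G (lam n) (p n)) :
  exists ps rs qs : {ptws 'I_N -> R},
    cluster ((fun n => (p n, (r_reg G (lam n), q_reg S G (lam n) (p n)))) @ \oo)
      (ps, (rs, qs)) /\
    [/\ R0 ps, R0 rs & R0 qs] /\
    exists q : {ptws 'I_N -> R} -> {ptws 'I_N -> R},
      q ps = qs /\ feedback_equilibrium S G ps rs q.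
Proof.
have [U [UU ooU]] := ultraFilterLemma (F := \oo) _.
have lamU : lam @ U --> (0 : R) by move=> V /lam_cvg0/ooU.
pose r n := r_reg G (lam n); pose q n := q_reg S G (lam n) (p n).
have p01 n : R0 (p n) by have [] := p_eq n.
have r01 n : R0 (r n) := @r_reg01 _ _ G (lam n).
have q01 n : R0 (q n) := @q_reg01 _ _ _ _ S G (lam n) (p n).
have limit (s : nat -> {ptws 'I_N -> R}) : (forall n, R0 (s n)) ->
    exists2 l : {ptws 'I_N -> R}, R0 l &
      forall x, (fun n => s n x : R) @ U --> (l x : R).
  move=> s01; have /choice[l lP] : forall x, exists l : R,
      0 <= l <= 1 /\ (fun n => s n x : R) @ U --> l.
    move=> x; have [n|l l01 sl] := @bounded_ultra_cvg R U UU 0 1 (s ^~ x).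
      exact: s01.
    by exists l.
  by exists l => x; have [] := lP x.
have [ps ps01 pcvg] := limit p p01.
have [rs rs01 rcvg] := limit r r01.
have [qs qs01 qcvg] := limit q q01.
exists ps, rs, qs; split.
  pose u n : {ptws 'I_N -> R} * ({ptws 'I_N -> R} * {ptws 'I_N -> R}) :=
    (p n, (r n, q n)).
  apply: (@cvg_subfilter_cluster _ _ _ _ u _ _ ooU).
  apply: cvg_pair_nbhs; first exact: ptws_cvg.
  by apply: cvg_pair_nbhs; exact: ptws_cvg.
split=> //.
have J2cvg x p' r' q' (p'' r'' q'' : {ptws 'I_N -> R}) :
    (forall n, R0 (p' n)) -> (forall n, R0 (r' n)) -> (forall n, R0 (q' n)) ->
    R0 p'' -> R0 r'' -> R0 q'' ->
    (forall x, (fun n => p' n x : R) @ U --> (p'' x : R)) ->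
    (forall x, (fun n => r' n x : R) @ U --> (r'' x : R)) ->
    (forall x, (fun n => q' n x : R) @ U --> (q'' x : R)) ->
    (fun n => J2 S G x (always (p' n)) (r' n, q' n)) @ U -->
      J2 S G x (always p'') (r'', q'').
  move=> *; rewrite J2E; under eq_fun do rewrite J2E.
  by apply: stop_value_ultra_cvg => //; exact: delta2_itv.
(* This optimality does not mention the leader's strategy, so the same [rs] can serve against every
   [p']. *)
have rs_max x s : 0 <= s <= 1 ->
    s * h2 G x + (1 - s) * g2 G x <= rs x * h2 G x + (1 - rs x) * g2 G x.
  move=> s01.
  have rhs_cvg : (fun n => r n x * h2 G x + (1 - r n x) * g2 G x + lam n) @ U -->
      rs x * h2 G x + (1 - rs x) * g2 G x + 0.
    apply: cvgD => //; apply: cvgD; apply: cvgMr_tmp; first exact: rcvg.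
    by apply: cvgB; [exact: cvg_cst|exact: rcvg].
  rewrite -[leRHS]addr0.
  apply: (ler_cvg_to (cvg_cst _) rhs_cvg); apply: filterE => n.
  exact: logistic_near_max.
have qs_best x r' q' : R0 r' -> R0 q' ->
    J2 S G x (always ps) (r', q') <= J2 S G x (always ps) (rs, qs).
  move=> r'01 q'01; rewrite -[leRHS]addr0 -[X in _ + X](mul0r (entropy_bound G)).
  have lhs : (fun n => J2 S G x (always (p n)) (r', q')) @ U -->
      J2 S G x (always ps) (r', q').
    by apply: (J2cvg x p (fun=> r') (fun=> q')) => // y; exact: cvg_cst.
  have rhs : (fun n => J2 S G x (always (p n)) (r n, q n) +
      lam n * entropy_bound G) @ U -->
      J2 S G x (always ps) (rs, qs) + 0 * entropy_bound G.
    by apply: cvgD; [exact: J2cvg|exact: cvgMr_tmp].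
  apply: (ler_cvg_to lhs rhs); apply: filterE => n.
  exact: regular_equilibrium_reply.
have /choice[best bestP] : forall p' : {ptws 'I_N -> R}, exists q' : {ptws 'I_N -> R},
    R0 p' -> R0 q' /\ forall x r1 q1, R0 r1 -> R0 q1 ->
      J2 S G x (always p') (r1, q1) <= J2 S G x (always p') (rs, q').
  move=> p'; have [p'01|np'] := pselect (R0 p'); last by exists p'.
  have [q' q'01 q'best] := best_reply_exists S p'01 rs01 rs_max.
  by exists q'.
(* At [ps] the reply must be the limit [qs] itself, which may differ from the selected [best ps]. *)
pose reply p' := if pselect (p' = ps) then qs else best p'.
have replyE : reply ps = qs by rewrite /reply; case: pselect.
have replyN p' : p' <> ps -> reply p' = best p'.
  by rewrite /reply; case: pselect.
exists reply; split=> //; split=> //.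
- move=> p' p'01; have [->|/replyN->] := pselect (p' = ps).
    by rewrite replyE.
  by have [] := bestP p' p'01.
- move=> x p' r' q' p'01 r'01 /(_ _ p'01) q'01.
  have [p'E|/replyN->] := pselect (p' = ps).
    by rewrite p'E replyE; apply: qs_best => //; rewrite -p'E.
  by have [_] := bestP p' p'01; apply.
- move=> x p' p'01; rewrite replyE !J1E.
  have dl01 := delta1_itv G.
  pose V p r q := stop_value S (delta1 G) (f1 G) (g1 G) (h1 G) r q (always p).
  have valcvg y : (fun n => V (p n) (r n) (q n) y) @ U --> V ps rs qs y.
    exact: stop_value_ultra_cvg.
  (* A one-step deviation to [p'] is worth one application of the Bellman operator to the stationary
     value, which converges. *)
  have lhs : (fun n => bellman S (delta1 G) (f1 G) (g1 G) (h1 G) p' (r n) (q n)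
      (V (p n) (r n) (q n)) x) @ U -->
      bellman S (delta1 G) (f1 G) (g1 G) (h1 G) p' rs qs (V ps rs qs) x.
    apply: (bellman_cvg (p := fun=> p')) => y.
    - exact: cvg_cst.
    - exact: rcvg.
    - exact: qcvg.
    - exact: valcvg.
  rewrite stop_value_first_then//; apply: (ler_cvg_to lhs (valcvg x)).
  apply: filterE => n.
  have := regular_equilibrium_leader x (p_eq n) p'01.
  rewrite !J1E.
  by rewrite (stop_value_first_then _ _ _ _ dl01 _ p'01 (p01 n) (r01 n) (q01 n)).
Qed.
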